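(* Let $B$ be an unbounded self-adjoint operator in $\mathcal{H}$. Then there are infinitely many pairs $\langle B_1,B_2\rangle$ of closed densely defined restrictions of $B$ such that (1) $\operatorname{dom}B_1\cap\operatorname{dom}B_2=\{0\}$; (2) $\operatorname{dom}B=\operatorname{dom}B_1\dotplus\operatorname{dom}B_2$; (3) $\operatorname{dom}B_1\cap\operatorname{dom}B^2=\operatorname{dom}B_2\cap\operatorname{dom}B^2=\{0\}$; (4) $\operatorname{dom}(BB_1)=\operatorname{dom}(BB_2)=\{0\}$; in particular $\operatorname{dom}B_1^2=\operatorname{dom}B_2^2=\{0\}$. If moreover $\operatorname{ran}B=\mathcal{H}$, then for $k=1,2$: (5) $B_kB$ is densely defined (and non-negative symmetric); (6) $B^2$ is the Friedrichs extension of $B_kB$; (7) $(B_kB)^*=BB_k^*$; (8) $\operatorname{dom}(B_1B)\cap\operatorname{dom}(B_2B)=\{0\}$ and $\operatorname{dom}(B_1B)\dotplus\operatorname{dom}(B_2B)=\operatorname{dom}B^2$; (9) the Kreĭn extension of $B_kB$ is $B_kB_k^*$.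
   Context: $\mathcal{H}$ is a complex, infinite-dimensional, separable Hilbert space. Products of unbounded operators have their natural domains, $\operatorname{dom}(ST)=\{f\in\operatorname{dom}T:Tf\in\operatorname{dom}S\}$. For a densely defined closed non-negative symmetric operator $\mathcal{A}$: the Friedrichs extension is the non-negative self-adjoint operator associated with the closure of the form $(\mathcal{A}f,g)$ on $\operatorname{dom}\mathcal{A}$ (maximal non-negative self-adjoint extension); the Kreĭn extension $\mathcal{A}_K$ is the minimal non-negative self-adjoint extension, i.e. $(\mathcal{A}_F+aI)^{-1}\le(\mathcal{C}+aI)^{-1}\le(\mathcal{A}_K+aI)^{-1}$, $a>0$, for every non-negative self-adjoint extension $\mathcal{C}$. $\dotplus$ denotes a direct sum. *)

(* Defs.v *)
From mathcomp Require Import all_boot all_algebra.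
From mathcomp Require Import complex.
From mathcomp Require Import boolp classical_sets reals.
Set Implicit Arguments. Unset Strict Implicit. Unset Printing Implicit Defensive.
Import GRing.Theory Num.Theory.
Local Open Scope ring_scope.
Local Open Scope classical_set_scope.

Section Hilbert.
Variable R : realType.
Variable V : lmodType R[i].
Variable ip : V -> V -> R[i].

Definition seq_converges (u : nat -> V) (x : V) : Prop :=
  forall eps : R[i], 0 < eps ->
    exists N : nat, forall n : nat, (N <= n)%N -> ip (u n - x) (u n - x) < eps.

Definition seq_cauchy (u : nat -> V) : Prop :=
  forall eps : R[i], 0 < eps ->
    exists N : nat, forall n m : nat, (N <= n)%N -> (N <= m)%N ->
      ip (u n - u m) (u n - u m) < eps.

Definition dense (D : set V) : Prop :=
  forall (x : V) (eps : R[i]), 0 < eps -> exists2 d, D d & ip (x - d) (x - d) < eps.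

Definition is_hilbert : Prop :=
  [/\ (forall (a : R[i]) (x y z : V), ip (a *: x + y) z = a * ip x z + ip y z),
      (forall x y : V, ip y x = (ip x y)^*%C),
      (forall x : V, 0 <= ip x x),
      (forall x : V, ip x x = 0 -> x = 0) &
      (forall u : nat -> V, seq_cauchy u -> exists x, seq_converges u x)] /\
   (
      (exists s : nat -> V, dense (range s)) /\
      (forall n : nat, exists x : 'I_n -> V,
          forall c : 'I_n -> R[i], \sum_(i < n) c i *: x i = 0 -> forall i, c i = 0)).

Record Op := mkOp { dom : set V; app : V -> V }.

Definition subspace (D : set V) : Prop :=
  D 0 /\ forall (a : R[i]) (x y : V), D x -> D y -> D (a *: x + y).

Definition linear_op (T : Op) : Prop :=
  subspace (dom T) /\
  forall (a : R[i]) (x y : V), dom T x -> dom T y ->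
    app T (a *: x + y) = a *: app T x + app T y.

Definition densely_defined (T : Op) : Prop := linear_op T /\ dense (dom T).

Definition closed_op (T : Op) : Prop :=
  linear_op T /\
  forall (u : nat -> V) (x y : V), (forall n, dom T (u n)) ->
    seq_converges u x -> seq_converges (fun n => app T (u n)) y ->
    dom T x /\ app T x = y.

Definition restriction (S T : Op) : Prop :=
  dom S `<=` dom T /\ forall x, dom S x -> app S x = app T x.

Definition comp (S T : Op) : Op :=
  mkOp [set f | dom T f /\ dom S (app T f)] (fun f => app S (app T f)).

Definition is_adjoint (T S : Op) : Prop :=
  densely_defined T /\
  dom S = [set g | exists h, forall f, dom T f -> ip (app T f) g = ip f h] /\
  (forall g, dom S g -> forall f, dom T f -> ip (app T f) g = ip f (app S g)).

Definition self_adjoint (T : Op) : Prop := is_adjoint T T.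

Definition symmetric (T : Op) : Prop :=
  densely_defined T /\
  forall f g, dom T f -> dom T g -> ip (app T f) g = ip f (app T g).

Definition nonneg (T : Op) : Prop := forall f, dom T f -> 0 <= ip (app T f) f.

Definition nonneg_self_adjoint (T : Op) : Prop := self_adjoint T /\ nonneg T.

Definition unbounded (T : Op) : Prop :=
  ~ exists M : R[i], forall f, dom T f -> ip (app T f) (app T f) <= M * ip f f.

Definition surjective_op (T : Op) : Prop := forall y, exists2 f, dom T f & app T f = y.

(* resolvent order: (C + aI)^{-1} <= (D + aI)^{-1} for all a > 0, i.e.
   ((C+a)^{-1} h, h) <= ((D+a)^{-1} h, h) for all h *)
Definition resolvent_le (C D : Op) : Prop :=
  forall (a : R[i]) (h u v : V), 0 < a ->
    dom C u -> app C u + a *: u = h ->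
    dom D v -> app D v + a *: v = h ->
    ip u h <= ip v h.

(* Friedrichs extension: maximal non-negative self-adjoint extension *)
Definition is_friedrichs (A F : Op) : Prop :=
  nonneg_self_adjoint F /\ restriction A F /\
  forall C, nonneg_self_adjoint C -> restriction A C -> resolvent_le F C.

(* Krein extension: minimal non-negative self-adjoint extension *)
Definition is_krein (A K : Op) : Prop :=
  nonneg_self_adjoint K /\ restriction A K /\
  forall C, nonneg_self_adjoint C -> restriction A C -> resolvent_le C K.

Definition direct_sum (D D1 D2 : set V) : Prop :=
  D1 `&` D2 = [set 0] /\ D = [set x + y | x in D1 & y in D2].

Definition zero_dom (T : Op) : Prop := dom T = [set 0].

Definition good_pair (B B1 B2 : Op) : Prop :=
  [/\ (closed_op B1 /\ densely_defined B1 /\ restriction B1 B) /\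
      (closed_op B2 /\ densely_defined B2 /\ restriction B2 B),
      (* (1) *) dom B1 `&` dom B2 = [set 0] /\
      (* (2) *) direct_sum (dom B) (dom B1) (dom B2),
      (* (3) *) dom B1 `&` dom (comp B B) = [set 0] /\ dom B2 `&` dom (comp B B) = [set 0],
      (* (4) *) (zero_dom (comp B B1) /\ zero_dom (comp B B2)) /\
                (zero_dom (comp B1 B1) /\ zero_dom (comp B2 B2)) &
      (surjective_op B ->
        (forall Bk, Bk = B1 \/ Bk = B2 ->
           (* (5) *) [/\ densely_defined (comp Bk B) /\ nonneg (comp Bk B) /\ symmetric (comp Bk B),
           (* (6) *) is_friedrichs (comp Bk B) (comp B B),
           (* (7) *) (forall Bks, is_adjoint Bk Bks -> is_adjoint (comp Bk B) (comp B Bks)) &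
           (* (9) *) (forall Bks, is_adjoint Bk Bks -> is_krein (comp Bk B) (comp Bk Bks))]) /\
        (* (8) *) (dom (comp B1 B) `&` dom (comp B2 B) = [set 0] /\
                   direct_sum (dom (comp B B)) (dom (comp B1 B)) (dom (comp B2 B))))].

End Hilbert.

(* Main.v *)
Require Import Defs.
From mathcomp Require Import all_boot all_order all_algebra.
From mathcomp Require Import complex.
From mathcomp Require Import boolp classical_sets reals.
From mathcomp Require Import ring lra.
Import Order.TTheory GRing.Theory Num.Theory.
Local Open Scope ring_scope.
Local Open Scope complex_scope.
Local Open Scope classical_set_scope.
Set Implicit Arguments. Unset Strict Implicit. Unset Printing Implicit Defensive.

(* Put A = B + i, a bijection of dom B onto V, and for a set F let B_F be the
   restriction of B to {b in dom B | A b _|_ F}. It is closed, and it is densely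
   defined as soon as F^perp^perp meets dom B only in 0. Hence the pair
   (B_F, B_(F^perp)) satisfies (1)-(4) whenever both F^perp and F^perp^perp meet
   dom B trivially: A carries the two domains onto F^perp and F^perp^perp, and
   b in dom B^2 forces A b into dom B.

   To produce such F, one builds pairwise orthogonal vectors s_k with s_k = A b_k,
   where b_k is close to A^-1 d_k and (d_k) runs infinitely often, along even as
   well as along odd indices, through a dense sequence. For x in dom B the numbers
   (x, s_k - d_k) = ((B - i) x, b_k - A^-1 d_k) tend to 0, so an x in dom B
   orthogonal to almost all s_k of one parity vanishes. The recursion does not stop
   because s_k is kept outside dom B + {s_j, j < k}^perp^perp, a proper subspace by
   the uniform boundedness principle. Then
   F_n = {s_0 + n s_1} U {s_2, s_4, ...} works for every n, and
   u_m = m |s_1|^2 s_0 - |s_0|^2 s_1 is orthogonal to F_n only for n = m.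

   When B is onto, B^-1 (dom T) is a form core of B^2 for every closed densely
   defined restriction T of B, which gives the Friedrichs extension; for the Krein
   extension, T^* v in dom T can be written B f with f in dom (T B), so that
   T T^* v = C f for every extension C of T B, and 0 <= (C (u - f), u - f) compares
   the resolvents. *)

(* is_hilbert without separability and infinite dimension, so that it can be
   established for V * V. *)
Definition hilbert_axioms (R : realType) (V : lmodType R[i])
    (ip : V -> V -> R[i]) : Prop :=
  [/\ (forall (a : R[i]) (x y z : V), ip (a *: x + y) z = a * ip x z + ip y z),
      (forall x y : V, ip y x = (ip x y)^*),
      (forall x : V, 0 <= ip x x),
      (forall x : V, ip x x = 0 -> x = 0) &
      (forall u : nat -> V, seq_cauchy ip u -> exists x, seq_converges ip u x)].

(** * Hilbert space geometry *)

Section HilbertSpace.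
Variables (R : realType) (V : lmodType R[i]) (ip : V -> V -> R[i]).
Hypothesis hilb : hilbert_axioms ip.

Lemma ipDl x y z : ip (x + y) z = ip x z + ip y z.
Proof. by case: hilb => H _ _ _ _; rewrite -[x]scale1r H mul1r scale1r. Qed.

Lemma ip0l z : ip 0 z = 0.
Proof. by apply: (addrI (ip 0 z)); rewrite -ipDl !addr0. Qed.

Lemma ipZl a x z : ip (a *: x) z = a * ip x z.
Proof. by case: hilb => H _ _ _ _; rewrite -[a *: x]addr0 H ip0l addr0. Qed.

Lemma ipNl x z : ip (- x) z = - ip x z.
Proof. by rewrite -scaleN1r ipZl mulN1r. Qed.

Lemma ipBl x y z : ip (x - y) z = ip x z - ip y z.
Proof. by rewrite ipDl ipNl. Qed.

Lemma ipC x y : ip y x = (ip x y)^*.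
Proof. by case: hilb. Qed.

Lemma ipDr x y z : ip z (x + y) = ip z x + ip z y.
Proof. by rewrite !(ipC _ z) ipDl rmorphD. Qed.

Lemma ip0r z : ip z 0 = 0.
Proof. by rewrite ipC ip0l rmorph0. Qed.

Lemma ipZr a x z : ip z (a *: x) = (a^*)%C * ip z x.
Proof. by rewrite !(ipC _ z) ipZl rmorphM. Qed.

Lemma ipNr x z : ip z (- x) = - ip z x.
Proof. by rewrite !(ipC _ z) ipNl rmorphN. Qed.

Lemma ipBr x y z : ip z (x - y) = ip z x - ip z y.
Proof. by rewrite ipDr ipNr. Qed.

(** Estimates are carried out in the underlying real inner product space, where they are
    inequalities in [R] within reach of [lra] and [nra]. *)
Definition rip x y : R := complex.Re (ip x y).

Lemma ripDl x y z : rip (x + y) z = rip x z + rip y z.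
Proof. by rewrite /rip ipDl; case: (ip x z) (ip y z) => ? ? []. Qed.

Lemma ripDr x y z : rip z (x + y) = rip z x + rip z y.
Proof. by rewrite /rip ipDr; case: (ip z x) (ip z y) => ? ? []. Qed.

Lemma ripNl x z : rip (- x) z = - rip x z.
Proof. by rewrite /rip ipNl; case: (ip x z). Qed.

Lemma ripNr x z : rip z (- x) = - rip z x.
Proof. by rewrite /rip ipNr; case: (ip z x). Qed.

Lemma ripZl (t : R) x z : rip (t%:C *: x) z = t * rip x z.
Proof. by rewrite /rip ipZl; case: (ip x z) => ? ? /=; rewrite mul0r subr0. Qed.

Lemma ripC x y : rip x y = rip y x.
Proof. by rewrite /rip ipC; case: (ip y x). Qed.

Lemma ripZr (t : R) x z : rip z (t%:C *: x) = t * rip z x.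
Proof. by rewrite !(ripC z) ripZl. Qed.

Lemma rip0l z : rip 0 z = 0. Proof. by rewrite /rip ip0l. Qed.
Lemma rip0r z : rip z 0 = 0. Proof. by rewrite /rip ip0r. Qed.

Definition ripE := (ripDl, ripDr, ripNl, ripNr, ripZl, ripZr, rip0l, rip0r).

Lemma ipxx x : ip x x = (rip x x)%:C.
Proof.
case: hilb => _ _ /(_ x) + _ _; rewrite lecE => /andP[/eqP/= im _].
by rewrite /rip; case: (ip x x) im => a b /= ->.
Qed.

Lemma rip_ge0 x : 0 <= rip x x.
Proof. by case: hilb => _ _ /(_ x) + _ _; rewrite ipxx lecR. Qed.

Lemma rip_eq0 x : rip x x = 0 -> x = 0.
Proof. by case: hilb => _ _ _ h _ e; apply: h; rewrite ipxx e. Qed.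

Lemma ip_rip0 x y : rip x y = 0 -> rip ('i *: x) y = 0 -> ip x y = 0.
Proof.
rewrite /rip ipZl; case: (ip x y) => a b /= ->.
by rewrite mul0r mul1r sub0r => /eqP; rewrite oppr_eq0 => /eqP ->.
Qed.

Definition nrm x := Num.sqrt (rip x x).

Lemma nrm_ge0 x : 0 <= nrm x. Proof. exact: sqrtr_ge0. Qed.

Lemma sqr_nrm x : nrm x ^+ 2 = rip x x.
Proof. by rewrite sqr_sqrtr // rip_ge0. Qed.

Lemma nrmN x : nrm (- x) = nrm x.
Proof. by rewrite /nrm !ripE opprK. Qed.

Lemma nrm_eq0 x : nrm x = 0 -> x = 0.
Proof. by move=> e; apply: rip_eq0; rewrite -sqr_nrm e expr0n. Qed.

Lemma nrmZ (t : R) x : nrm (t%:C *: x) = `|t| * nrm x.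
Proof. by rewrite /nrm !ripE mulrA -expr2 sqrtrM ?sqr_ge0// sqrtr_sqr. Qed.

Lemma rip_le_nrm x y : rip x y <= nrm x * nrm y.
Proof.
have [e|n0] := eqVneq (nrm y) 0.
  by rewrite (nrm_eq0 e) rip0r mulr_ge0 // nrm_ge0.
have y0 : 0 < nrm y by rewrite lt_def n0 nrm_ge0.
have := rip_ge0 ((nrm y)%:C *: x - (nrm x)%:C *: y).
rewrite !ripE -!sqr_nrm (ripC y x) => h.
have [e|n1] := eqVneq (nrm x) 0.
  by rewrite (nrm_eq0 e) rip0l mulr_ge0 // nrm_ge0.
have x0 : 0 < nrm x by rewrite lt_def n1 nrm_ge0.
have xy := mulr_gt0 x0 y0.
rewrite -(ler_pM2l xy); nra.
Qed.

Lemma normr_rip_le_nrm x y : `|rip x y| <= nrm x * nrm y.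
Proof.
rewrite ler_norml rip_le_nrm andbT lerNl -ripNl.
by rewrite -[nrm x]nrmN rip_le_nrm.
Qed.

Lemma nrmD x y : nrm (x + y) <= nrm x + nrm y.
Proof.
have h : nrm (x + y) ^+ 2 <= (nrm x + nrm y) ^+ 2.
  rewrite sqr_nrm !ripE -!sqr_nrm (ripC y x); have := rip_le_nrm x y; nra.
by rewrite -(@ler_pXn2r _ 2) ?nnegrE ?addr_ge0 ?nrm_ge0.
Qed.

Lemma nrm_distC x y : nrm (x - y) = nrm (y - x).
Proof. by rewrite -nrmN opprB. Qed.

Lemma nrm_distD z x y : nrm (x - y) <= nrm (x - z) + nrm (z - y).
Proof. by apply: le_trans (nrmD _ _); rewrite addrA subrK. Qed.

Lemma nrm_lt x (e : R) : 0 < e -> (nrm x < e) = (rip x x < e ^+ 2).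
Proof.
by move=> e0; rewrite -sqr_nrm ltr_pXn2r // nnegrE ?nrm_ge0 // ltW.
Qed.

Lemma posC (eps : R[i]) : 0 < eps -> exists2 e : R, 0 < e & eps = (e ^+ 2)%:C.
Proof.
case: eps => a b; rewrite ltcE /= => /andP[/eqP -> a0].
by exists (Num.sqrt a); rewrite ?sqrtr_gt0// sqr_sqrtr // ltW.
Qed.

Lemma ip_lt x (e : R) : 0 < e -> (ip x x < (e ^+ 2)%:C) = (nrm x < e).
Proof. by move=> e0; rewrite nrm_lt // ipxx ltcR. Qed.

Lemma sqrC_gt0 (e : R) : 0 < e -> 0 < (e ^+ 2)%:C :> R[i].
Proof. by move=> e0; rewrite ltcR exprn_gt0. Qed.

Lemma seq_convergesP u x : seq_converges ip u x <->
  forall e : R, 0 < e -> exists N, forall n, (N <= n)%N -> nrm (u n - x) < e.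
Proof.
split=> h e e0.
  by have [N hN] := h _ (sqrC_gt0 e0); exists N => n /hN; rewrite ip_lt.
have [d d0 ->] := posC e0; have [N hN] := h d d0.
by exists N => n /hN; rewrite ip_lt.
Qed.

Lemma nrm_cauchy_cvg u :
  (forall e : R, 0 < e -> exists N, forall n m, (N <= n)%N -> (N <= m)%N ->
     nrm (u n - u m) < e) -> exists x, seq_converges ip u x.
Proof.
move=> h; case: hilb => _ _ _ _; apply=> e e0.
have [d d0 ->] := posC e0; have [N hN] := h d d0.
by exists N => n m nN mN; rewrite ip_lt// hN.
Qed.

Definition adherent (S : set V) x :=
  forall e : R, 0 < e -> exists2 s, S s & nrm (x - s) < e.

Lemma denseP D : dense ip D <-> forall x, adherent D x.
Proof.
split=> h x e e0.
  by have [d Dd] := h x _ (sqrC_gt0 e0); rewrite ip_lt// => ?; exists d.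
have [d d0 ->] := posC e0; have [s Ss] := h x d d0.
by exists s => //; rewrite ip_lt.
Qed.

Lemma harm_lt (e : R) : 0 < e -> exists N, forall n, (N <= n)%N -> n.+1%:R^-1 < e.
Proof.
move=> e0; exists (Num.truncn e^-1) => n nN.
rewrite -[e]invrK ltf_pV2 ?posrE ?invr_gt0 ?ltr0n//.
apply: lt_le_trans (truncnS_gt _) _.
by rewrite ler_nat.
Qed.

Lemma adherent_seq S x : adherent S x ->
  exists u, (forall n, S (u n)) /\ seq_converges ip u x.
Proof.
move=> h.
have /choice[u hu] (n : nat) : exists s, S s /\ nrm (x - s) < n.+1%:R^-1.
  have n0 : 0 < n.+1%:R^-1 :> R by rewrite invr_gt0 ltr0n.
  by have [s ? ?] := h _ n0; exists s.
exists u; split=> [n|]; first by case: (hu n).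
apply/seq_convergesP => e /harm_lt[N hN]; exists N => n /hN; apply: lt_trans.
by rewrite nrm_distC; case: (hu n).
Qed.

Lemma cvg_adherent S u x :
  (forall n, S (u n)) -> seq_converges ip u x -> adherent S x.
Proof.
move=> Su /seq_convergesP h e /h[N hN]; exists (u N) => //.
by rewrite nrm_distC hN.
Qed.

Lemma le0_of_lt (a c : R) : (forall e, 0 < e -> a < c * e) -> 0 <= c -> a <= 0.
Proof.
move=> h c0; rewrite leNgt; apply/negP => a0.
have c1 : 0 < c + 1 by rewrite ltr_wpDl.
have := h (a / (c + 1)) (divr_gt0 a0 c1).
rewrite mulrA ltr_pdivlMr //; nra.
Qed.

Lemma adherent_rip0 S x z :
  adherent S x -> (forall s, S s -> rip s z = 0) -> rip x z = 0.
Proof.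
move=> xS h; apply/eqP; rewrite -normr_le0.
apply: (@le0_of_lt _ (nrm z + 1)) => [e e0|]; last by rewrite addr_ge0 ?nrm_ge0.
have [s /h s0 lt] := xS e e0.
rewrite -[rip x z]subr0 -s0 -ripNl -ripDl.
apply: le_lt_trans (normr_rip_le_nrm _ _) _.
have := nrm_ge0 z; nra.
Qed.

Lemma adherent_ip0 S x z :
  adherent S x -> (forall s, S s -> ip s z = 0) -> ip x z = 0.
Proof.
move=> xS h; apply: ip_rip0.
  by apply: adherent_rip0 xS _ => s /h; rewrite /rip => ->.
(* [S] need not be stable under ['i], so the factor is moved to [z]. *)
suff -> : rip ('i *: x) z = - rip x ('i *: z).
  rewrite (@adherent_rip0 S x) ?oppr0// => s /h.
  by rewrite /rip ipZr => ->; rewrite mulr0.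
rewrite /rip ipZl ipZr; case: (ip x z) => a b /=; ring.
Qed.

Lemma subspaceZ (S : set V) a x : subspace S -> S x -> S (a *: x).
Proof. by move=> [S0 h] Sx; rewrite -[_ *: _]addr0; apply: h. Qed.

Lemma subspaceD (S : set V) x y : subspace S -> S x -> S y -> S (x + y).
Proof. by move=> [S0 h] Sx Sy; rewrite -[x]scale1r; apply: h. Qed.

Lemma subspaceN (S : set V) x : subspace S -> S x -> S (- x).
Proof. by move=> hS Sx; rewrite -scaleN1r; apply: subspaceZ. Qed.

Lemma subspaceB (S : set V) x y : subspace S -> S x -> S y -> S (x - y).
Proof. by move=> hS Sx Sy; apply: subspaceD => //; apply: subspaceN. Qed.

(** A sequence minimising the distance to [x] is Cauchy. As [S] need not be closed, its limit [p] is
    only adherent to [S]. *)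
Lemma projection S x : subspace S ->
  exists p, adherent S p /\ forall s, S s -> ip s (x - p) = 0.
Proof.
move=> hS.
pose E : set R := [set rip (x - s) (x - s) | s in S].
have E0 : E !=set0 by exists (rip (x - 0) (x - 0)); exists 0 => //; case: hS.
have Elb : has_lbound E by exists 0 => _ [s _ <-]; exact: rip_ge0.
have minE s : S s -> inf E <= rip (x - s) (x - s).
  by move=> Ss; apply: ge_inf => //; exists s.
have /choice[u hu] (n : nat) :
    exists s, S s /\ rip (x - s) (x - s) < inf E + n.+1%:R^-1.
  have n0 : 0 < n.+1%:R^-1 :> R by rewrite invr_gt0 ltr0n.
  have [_ [s Ss <-] ?] := inf_adherent n0 (conj E0 Elb).
  by exists s.
have Su n : S (u n) by case: (hu n).
have [p up] : exists p, seq_converges ip u p.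
  apply: nrm_cauchy_cvg => e e0.
  have e4 : 0 < e ^+ 2 / 4 by rewrite divr_gt0 ?exprn_gt0.
  have [N hN] := harm_lt e4; exists N => n m /hN nN /hN mN.
  rewrite nrm_lt //.
  (* Parallelogram law: the midpoint of [u n] and [u m] lies in [S], so its distance to [x] is
     bounded below by the infimum. *)
  have := minE _ (subspaceZ (2^-1)%:C hS (subspaceD hS (Su n) (Su m))).
  have [_] := hu n; have [_] := hu m; rewrite !ripE.
  rewrite (ripC (u n) x) (ripC (u m) x) (ripC (u m) (u n)).
  move: nN mN; move: (n.+1%:R^-1) (m.+1%:R^-1) => a b; lra.
exists p; split; first exact: cvg_adherent up.
have key s : S s -> rip s (x - p) = 0.
  move=> Ss; apply/eqP; rewrite -normr_le0.
  apply: (@le0_of_lt _ (2 * (nrm s + 1))); last first.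
    by rewrite mulr_ge0 ?addr_ge0 ?nrm_ge0.
  move=> e e0.
  have [N1 hN1] := harm_lt (exprn_gt0 2 e0).
  have /seq_convergesP/(_ e e0)[N2 hN2] := up.
  pose n := maxn N1 N2.
  have {}hN1 := hN1 n (leq_maxl _ _); have {}hN2 := hN2 n (leq_maxr _ _).
  have [_ hn] := hu n.
  have bnd : `|rip s (x - u n)| <= nrm s * e.
    have [s0|sn0] := eqVneq (nrm s) 0.
      by rewrite (nrm_eq0 s0) rip0l normr0 mulr_ge0 ?nrm_ge0// ltW.
    have s0 : 0 < nrm s by rewrite lt_def sn0 nrm_ge0.
    have ss0 : 0 < rip s s by rewrite -sqr_nrm exprn_gt0.
    (* [t] minimises the distance from [x] to [u n + t s]; comparison with the infimum leaves
       [t ^+ 2 * rip s s < e ^+ 2]. *)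
    pose t := rip s (x - u n) / rip s s.
    have := minE _ (subspaceD hS (Su n) (subspaceZ t%:C hS Ss)).
    have -> : x - (u n + t%:C *: s) = (x - u n) - t%:C *: s.
      by rewrite opprD addrA.
    rewrite [in X in inf E <= X -> _]ripDl ripNl ripZl.
    rewrite ![rip _ (x - u n - _)]ripDr !ripNr !ripZr (ripC (x - u n) s).
    have te : t * rip s s = rip s (x - u n) by rewrite /t divfK // gt_eqF.
    rewrite -te => h.
    have : t ^+ 2 * rip s s < e ^+ 2 by move: h hn hN1; move: (n.+1%:R^-1) => a; nra.
    rewrite -sqr_nrm -exprMn => h2.
    have : `|t * nrm s| < e.
      rewrite -(@ltr_pXn2r _ 2) ?nnegrE// ?(ltW e0)//.
      by rewrite real_normK ?num_real.
    rewrite expr2 mulrA !normrM (ger0_norm (ltW s0)) => h3.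
    by rewrite [leRHS]mulrC ler_wpM2r ?ltW.
  rewrite -[x - p](subrKA (u n)) ripDr.
  apply: le_lt_trans (ler_normD _ _) _.
  have := normr_rip_le_nrm s (u n - p); have := nrm_ge0 s.
  nra.
move=> s Ss; apply: ip_rip0; first exact: key.
by apply: key; apply: subspaceZ.
Qed.

End HilbertSpace.

(** * Operators and their graphs *)

Section Product.
Variables (R : realType) (V : lmodType R[i]) (ip : V -> V -> R[i]).
Hypothesis hilb : hilbert_axioms ip.

(** The Hilbert sum of two copies of [V], in which closedness of an operator becomes closedness of
    its graph. *)
Definition ip_prod (u v : V * V) := ip u.1 v.1 + ip u.2 v.2.

Let ip_ge0 x : 0 <= ip x x. Proof. by case: hilb. Qed.

Lemma seq_converges_prod u x : seq_converges ip_prod u x <->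
  seq_converges ip (fst \o u) x.1 /\ seq_converges ip (snd \o u) x.2.
Proof.
split=> [h|[h1 h2] e e0].
  split=> e /h[N hN]; exists N => n /hN; apply: le_lt_trans.
    by rewrite /ip_prod lerDl.
  by rewrite /ip_prod lerDr.
have e2 : 0 < e / 2 by rewrite divr_gt0.
have [N1 h1N] := h1 _ e2; have [N2 h2N] := h2 _ e2.
exists (maxn N1 N2) => n; rewrite geq_max => /andP[/h1N lt1 /h2N lt2].
by rewrite [e]splitr ltrD.
Qed.

Lemma hilbert_prod : hilbert_axioms ip_prod.
Proof.
split=> [a x y z|x y|x|x|u cu].
- by rewrite /ip_prod /= !(ipDl hilb) !(ipZl hilb) mulrDr addrACA.
- by rewrite /ip_prod (ipC hilb x.1) (ipC hilb x.2) rmorphD.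
- by rewrite addr_ge0.
- move/eqP; rewrite paddr_eq0// => /andP[/eqP e1 /eqP e2].
  case: hilb => _ _ _ h _.
  by rewrite [x]surjective_pairing (h _ e1) (h _ e2).
- case: hilb => _ _ _ _ h.
  have [x1 c1] : exists x, seq_converges ip (fst \o u) x.
    apply: h => e /cu[N hN]; exists N => n m nN /(hN _ _ nN).
    by apply: le_lt_trans; rewrite /ip_prod lerDl.
  have [x2 c2] : exists x, seq_converges ip (snd \o u) x.
    apply: h => e /cu[N hN]; exists N => n m nN /(hN _ _ nN).
    by apply: le_lt_trans; rewrite /ip_prod lerDr.
  by exists (x1, x2); apply/seq_converges_prod.
Qed.

Lemma rip_prod u v : rip ip_prod u v = rip ip u.1 v.1 + rip ip u.2 v.2.
Proof. by rewrite /rip /ip_prod; case: (ip u.1 v.1) (ip u.2 v.2) => ? ? []. Qed.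

End Product.

Section Operators.
Variables (R : realType) (V : lmodType R[i]) (ip : V -> V -> R[i]).
Hypothesis hilb : hilbert_axioms ip.
Implicit Types (S F : set V) (T A : Op V).

Let ip0 x : ip x x = 0 -> x = 0. Proof. by case: hilb => _ _ _ h _; apply: h. Qed.
Let ip_ge0 x : 0 <= ip x x. Proof. by case: hilb. Qed.

Lemma ip_eq0C x y : ip x y = 0 -> ip y x = 0.
Proof. by rewrite (ipC hilb x) => ->; rewrite rmorph0. Qed.

(** * Orthogonal complements; [oc (oc F)] is the closed linear span of [F] *)

Definition oc F : set V := [set y | forall f, F f -> ip f y = 0].

Lemma oc_subspace F : subspace (oc F).
Proof.
split=> [f _|a x y Fx Fy f Ff]; first exact: ip0r.
by rewrite (ipDr hilb) (ipZr hilb) Fx ?Fy// mulr0 addr0.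
Qed.

Lemma sub_ococ F : F `<=` oc (oc F).
Proof. by move=> f Ff y /(_ f Ff); apply: ip_eq0C. Qed.

Lemma oc_anti F G : F `<=` G -> oc G `<=` oc F.
Proof. by move=> FG y yG f /FG/yG. Qed.

Lemma ocococ F : oc (oc (oc F)) = oc F.
Proof.
apply/seteqP; split; last exact: sub_ococ.
exact/oc_anti/sub_ococ.
Qed.

Lemma oc_capC F y : oc F y -> oc (oc F) y -> y = 0.
Proof. by move=> yF /(_ y yF); apply: ip0. Qed.

Lemma adherent_oc F x : adherent ip (oc F) x -> oc F x.
Proof.
move=> xF f Ff; apply/ip_eq0C/(adherent_ip0 hilb xF) => s /(_ f Ff).
exact: ip_eq0C.
Qed.

Lemma oc_decomp F x : exists p q, [/\ oc F p, oc (oc F) q & x = p + q].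
Proof.
have [p [/adherent_oc pF h]] := projection hilb x (oc_subspace F).
by exists p, (x - p); split => //; rewrite addrC subrK.
Qed.

(** The component of [x] orthogonal to [S] stays in the closed subspace [M] and therefore vanishes.
    [M = setT] gives density in [V]; [M = graph B] gives density in the graph norm. *)
Lemma adherent_of_oc (S M : set V) : subspace S -> subspace M -> S `<=` M ->
  (forall x, adherent ip M x -> M x) ->
  (forall z, M z -> (forall s, S s -> ip s z = 0) -> z = 0) ->
  forall x, M x -> adherent ip S x.
Proof.
move=> hS hM SM clM h x Mx; have [p [pS xp]] := projection hilb x hS.
suff -> : x = p by [].
apply/eqP; rewrite -subr_eq0; apply/eqP/h => //.
apply: subspaceB => //; apply: clM => e /pS[s /SM Ms lt]; by exists s.
Qed.

Lemma dense_oc S : subspace S -> (forall z, oc S z -> z = 0) -> dense ip S.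
Proof.
move=> hS h; apply/(denseP hilb) => x.
by apply: (@adherent_of_oc S setT) => // z _; apply: h.
Qed.

Lemma oc_dense S z : dense ip S -> oc S z -> z = 0.
Proof.
move=> /(denseP hilb)/(_ z) zS h; apply: ip0.
exact: (adherent_ip0 hilb zS).
Qed.

Definition graph T : set (V * V) := [set u | dom T u.1 /\ u.2 = app T u.1].

Lemma linear_op0 T : linear_op T -> app T 0 = 0.
Proof.
move=> [[T0 _] lT]; have := lT 1 0 0 T0 T0.
by rewrite !scale1r addr0 -[LHS]addr0 => /addrI.
Qed.

Lemma linear_opZ T a x : linear_op T -> dom T x -> app T (a *: x) = a *: app T x.
Proof.
move=> lT dx; have [[T0 _] h] := lT.
by rewrite -[a *: x]addr0 h// linear_op0// addr0.
Qed.

Lemma linear_opD T x y : linear_op T -> dom T x -> dom T y ->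
  app T (x + y) = app T x + app T y.
Proof. by move=> [_ h] dx dy; rewrite -{1}[x]scale1r h// scale1r. Qed.

Lemma linear_opB T x y : linear_op T -> dom T x -> dom T y ->
  app T (x - y) = app T x - app T y.
Proof.
move=> lT dx dy; have [sT _] := lT.
rewrite linear_opD//; last exact: subspaceN.
by rewrite -[- y]scaleN1r linear_opZ// scaleN1r.
Qed.

Lemma graph_subspace T : linear_op T -> subspace (graph T).
Proof.
move=> lT; split; first by split; [case: lT => -[] | rewrite linear_op0].
move=> a [x1 x2] [y1 y2] [/= dx /= ->] [/= dy /= ->]; case: lT => [[_ h] lT].
by split; [exact: h|rewrite lT].
Qed.

Lemma adherent_graph T u :
  closed_op ip T -> adherent (ip_prod ip) (graph T) u -> graph T u.
Proof.
move=> [lT cT] /(adherent_seq (hilbert_prod hilb))[v [vT]].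
move=> /seq_converges_prod-/(_ hilb)[v1 v2].
have [|d e] := cT (fst \o v) u.1 u.2 (fun n => (vT n).1) v1; last by split.
have -> // : (fun n => app T ((fst \o v) n)) = snd \o v.
by apply/funext => n /=; rewrite (vT n).2.
Qed.

(** * Adjoints and the operator [T T^*] *)

Lemma adjoint_intro T (S : Op V) g h : is_adjoint ip T S ->
  (forall f, dom T f -> ip (app T f) g = ip f h) -> dom S g /\ app S g = h.
Proof.
move=> [[_ dT] [dS aS]] gh; have Sg : dom S g by rewrite dS; exists h.
split=> //; apply/eqP; rewrite -subr_eq0; apply/eqP/(oc_dense dT) => f df.
by rewrite (ipBr hilb) -aS// gh// subrr.
Qed.

Lemma adjoint_linear T (S : Op V) : is_adjoint ip T S -> linear_op S.
Proof.
move=> TS; have [_ [_ aS]] := TS.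
have lin a x y : dom S x -> dom S y ->
    dom S (a *: x + y) /\ app S (a *: x + y) = a *: app S x + app S y.
  move=> dx dy; apply: (adjoint_intro TS) => f df.
  by rewrite !(ipDr hilb) !(ipZr hilb) !aS.
split; last by move=> a x y dx dy; have [] := lin a x y dx dy.
split; last by move=> a x y dx dy; have [] := lin a x y dx dy.
by have [] := @adjoint_intro T S 0 0 TS => // f _; rewrite !(ip0r hilb).
Qed.

(** The graph of [S] is the set of pairs orthogonal to all [(app T f, - f)], hence closed. *)
Lemma adjoint_closed T (S : Op V) : is_adjoint ip T S -> closed_op ip S.
Proof.
move=> TS; split=> [|u x y du ux uy]; first exact: adjoint_linear TS.
apply: (adjoint_intro TS) => f df; have [_ [_ aS]] := TS.
have xy : adherent (ip_prod ip) (graph S) (x, y).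
  apply: (@cvg_adherent _ _ _ (hilbert_prod hilb) _ (fun n => (u n, app S (u n)))).
    by move=> n; exact: (conj (du n) erefl).
  exact/seq_converges_prod.
have := adherent_ip0 (hilbert_prod hilb) xy (z := (app T f, - f)).
rewrite /ip_prod /= (ipNr hilb) => h.
have /eqP : ip x (app T f) - ip y f = 0.
  apply: h => -[s1 s2] [/= ds /= ->]; rewrite (ipNr hilb) (ipC hilb (app T f)) aS//.
  by rewrite -(ipC hilb) subrr.
by rewrite subr_eq0 => /eqP e; rewrite (ipC hilb x) e -(ipC hilb).
Qed.

Lemma self_adjoint_of_surjective A : linear_op A -> nonneg ip A ->
  (forall f g, dom A f -> dom A g -> ip (app A f) g = ip f (app A g)) ->
  (forall h, exists2 u, dom A u & app A u + u = h) -> self_adjoint ip A.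
Proof.
move=> lA nA symA surjA; split; last split=> [|g dg f df]; last exact: symA.
  split=> //; apply: dense_oc; first by case: lA.
  (* A vector orthogonal to the domain has the form [A u + u]; pairing it with [u] gives two
     non-negative terms with sum 0. *)
  move=> g; have [u du <-] := surjA g => /(_ u du)/eqP.
  rewrite (ipDr hilb) -symA// paddr_eq0 ?nA// => /andP[_ /eqP/ip0 ->].
  by rewrite linear_op0 ?addr0.
apply/seteqP; split=> [g dg|g [h gh]]; first by exists (app A g) => f df; exact: symA.
(* For [g] in the domain of the adjoint with image [h], the difference [g - u] is orthogonal to the
   range of [A + 1], which is all of [V]. *)
have [u du e] := surjA (g + h).
suff -> : g = u by [].
apply/eqP; rewrite -subr_eq0; apply/eqP/ip0.
have [f df fe] := surjA (g - u).
rewrite -{1}fe (ipDl hilb) !(ipBr hilb) gh// symA//.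
have := congr1 (ip f) e; rewrite !(ipDr hilb) => e'.
apply/eqP; rewrite addrACA -opprD subr_eq0 e'; apply/eqP; ring.
Qed.

Lemma comp_linear (S T : Op V) : linear_op S -> linear_op T -> linear_op (Defs.comp S T).
Proof.
move=> [sS lS] [sT lT]; have T0 := linear_op0 (conj sT lT).
split; first split=> /=.
- by rewrite T0; split; [case: sT|case: sS].
- move=> a x y [dx dTx] [dy dTy]; split; first by case: sT => _; apply.
  by rewrite lT//; case: sS => _; apply.
- by move=> a x y [dx dTx] [dy dTy] /=; rewrite lT// lS.
Qed.

(* The graph of T and the flipped graph of its adjoint are orthogonal complements
   in V * V; decomposing (0, h) solves the equation. *)
Lemma comp_adjoint_surjective T (S : Op V) h : closed_op ip T -> is_adjoint ip T S ->
  exists2 u, dom (Defs.comp T S) u & app T (app S u) + u = h.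
Proof.
move=> cT TS; have [lT _] := cT.
have [[v w] [/(adherent_graph cT)[/= dv /= ->] orth]] :=
  projection (hilbert_prod hilb) (0, h) (graph_subspace lT).
have [|db eb] := @adjoint_intro T S (h - app T v) v TS.
  move=> f df; have := orth (f, app T f) (conj df erefl).
  rewrite /ip_prod /= sub0r (ipNr hilb) addrC => /eqP.
  by rewrite subr_eq0 => /eqP.
exists (h - app T v); first by split=> //; rewrite eb.
by rewrite eb addrC subrK.
Qed.

(** Von Neumann's theorem on [T T^*], through the surjectivity of [T T^* + 1]. *)
Lemma comp_adjoint_nonneg_self_adjoint T (S : Op V) :
  closed_op ip T -> is_adjoint ip T S -> nonneg_self_adjoint ip (Defs.comp T S).
Proof.
move=> cT TS; have [lT _] := cT; have lS := adjoint_linear TS.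
have [_ [_ aS]] := TS.
have nA : nonneg ip (Defs.comp T S) by move=> f [df dTf] /=; rewrite aS.
split=> //; apply: self_adjoint_of_surjective => //.
- exact: comp_linear.
- move=> f g [df dTf] [dg dTg] /=.
  by rewrite aS// [RHS](ipC hilb) aS// -(ipC hilb).
- by move=> h; apply: comp_adjoint_surjective.
Qed.

Lemma self_adjoint_symmetric T f g : self_adjoint ip T ->
  dom T f -> dom T g -> ip (app T f) g = ip f (app T g).
Proof. by move=> [_ [_ h]] df dg; apply: h. Qed.

(** Resolvent inequalities live in [R[i]]; non-negativity forces [ip (app T v) v] to be real, which
    reduces them to inequalities in [R]. *)
Lemma ip_shift_real T v (t : R) : 0 <= ip (app T v) v ->
  ip v (app T v + t%:C *: v) = (rip ip v (app T v + t%:C *: v))%:C.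
Proof.
rewrite /rip (ipDr hilb) (ipZr hilb) (ipxx hilb) (ipC hilb (app T v) v).
case: (ip (app T v) v) => a b; rewrite lecE /= => /andP[/eqP -> _].
by apply/eqP; rewrite eq_complex /= !(mulr0, mul0r, oppr0, addr0, subr0, eqxx).
Qed.

End Operators.

(** * The products T B and T T^* for a restriction T of B *)

Section Restriction.
Variables (R : realType) (V : lmodType R[i]) (ip : V -> V -> R[i]).
Hypothesis hilb : hilbert_axioms ip.
Variable B : Op V.
Hypothesis saB : self_adjoint ip B.

Let ip_ge0 x : 0 <= ip x x. Proof. by case: hilb. Qed.

Let lB : linear_op B. Proof. by case: saB => -[]. Qed.
Let cB : closed_op ip B. Proof. exact: adjoint_closed saB. Qed.
Let symB f g : dom B f -> dom B g -> ip (app B f) g = ip f (app B g).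
Proof. exact: self_adjoint_symmetric. Qed.

Variable T : Op V.
Hypotheses (clT : closed_op ip T) (ddT : densely_defined ip T).
Hypotheses (TB : restriction T B) (surB : surjective_op B).

Let dTB x : dom T x -> dom B x. Proof. exact: TB.1. Qed.
Let appT x : dom T x -> app T x = app B x. Proof. exact: TB.2. Qed.

(** As [B] is onto, it carries [dom (T B)] onto [dom T]. If [y = B w] is orthogonal to the former,
    then [w] is orthogonal to the dense set [dom T]. *)
Lemma comp_restriction_dense : densely_defined ip (Defs.comp T B).
Proof.
have lTB := comp_linear clT.1 lB.
split=> //; apply: (dense_oc hilb); first by case: lTB.
move=> y hy; have [w dw we] := surB y.
suff w0 : w = 0 by rewrite -we w0 linear_op0.
apply: (oc_dense hilb ddT.2) => x dx; have [f df fx] := surB x.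
rewrite -fx symB// we; apply: hy; split=> //=.
by rewrite fx.
Qed.

Lemma comp_restriction_sub : restriction (Defs.comp T B) (Defs.comp B B).
Proof.
by split=> x [dx dTx] /=; [split=> //; apply: dTB|rewrite appT].
Qed.

Lemma comp_restriction_nonneg : nonneg ip (Defs.comp T B).
Proof.
by move=> f [df dTf] /=; rewrite appT// symB//; apply: dTB.
Qed.

Lemma comp_restriction_symmetric : Defs.symmetric ip (Defs.comp T B).
Proof.
split; first exact: comp_restriction_dense.
move=> f g [df dTf] [dg dTg] /=.
by rewrite !appT// !symB//; apply: dTB.
Qed.

Lemma comp_restriction_core u (e : R) : dom B u -> 0 < e ->
  exists2 f, dom (Defs.comp T B) f &
    nrm ip (u - f) < e /\ nrm ip (app B u - app B f) < e.
Proof.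
move=> du e0; pose A := mkOp (dom (Defs.comp T B)) (app B).
have lA : linear_op A.
  have [sTB _] := comp_linear clT.1 lB; split=> // a x y [dx _] [dy _] /=.
  by case: lB => _; apply.
have AB : graph A `<=` graph B by move=> [x y] [/= [dx _] /= ->].
have [|[f f'] [/= df /= ->] lt] :=
    @adherent_of_oc _ _ _ (hilbert_prod hilb) (graph A) (graph B)
      (graph_subspace lA) (graph_subspace lB) AB
      (fun x => adherent_graph hilb cB (u := x)) _ (u, app B u) (conj du erefl) e e0.
  move=> [w w'] [/= dw /= ->] h.
  suff -> : w = 0 by rewrite linear_op0.
  (* With [w = B s], orthogonality to [(f, B f)] reads [(B f, s + B w) = 0]. Here [B f] runs through
     [dom T], so [B w = - s] and [(w, w) = (s, B w) = - (s, s)]. *)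
  have [s ds es] := surB w.
  have e1 : s + app B w = 0.
    apply: (oc_dense hilb ddT.2) => x dx; have [f df fx] := surB x.
    have := h (f, app B f); rewrite /ip_prod /= -{1}es -symB//.
    rewrite fx -(ipDr hilb); apply; split=> //; split=> //=.
    by rewrite fx.
  have /eqP : ip w w + ip s s = 0.
    rewrite -{1}es symB// -(ipDr hilb) addrC e1.
    exact: ip0r.
  rewrite paddr_eq0// => /andP[/eqP w0 _].
  by case: hilb => _ _ _ + _; apply.
exists f => //; move: lt; rewrite !(nrm_lt (hilbert_prod hilb), nrm_lt hilb)//.
have := rip_ge0 hilb (u - f); have := rip_ge0 hilb (app B u - app B f).
rewrite rip_prod /=; move: (rip ip _ _) (rip ip _ _) => p q p0 q0 lt; split; lra.
Qed.

(** On [dom (T B)] the extension [C] agrees with [B^2], so for [f] there the non-negative number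
    [(C (v - f), v - f) + a |v - f|^2] equals [(v, h) - (u, h) + |B (u - f)|^2 + a |u - f|^2]. The
    core property makes the last two terms small. *)
Lemma comp_restriction_friedrichs : is_friedrichs ip (Defs.comp T B) (Defs.comp B B).
Proof.
split; first exact: comp_adjoint_nonneg_self_adjoint.
split; first exact: comp_restriction_sub.
move=> C [saC nC] [dC eC] a h u v a0 [du dBu] eu dv ev.
have [t t0 at_] : exists2 t : R, 0 < t & a = t%:C.
  by have [s s0 ->] := posC a0; exists (s ^+ 2); rewrite ?exprn_gt0.
subst a.
have ureal : ip u h = (rip ip u h)%:C.
  rewrite -eu; apply: (@ip_shift_real _ _ _ hilb (Defs.comp B B)) => /=.
  by rewrite symB.
have vreal : ip v h = (rip ip v h)%:C.
  by rewrite -ev; apply: ip_shift_real => //; apply: nC.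
rewrite ureal vreal lecR -subr_le0.
apply: (@le0_of_lt _ _ (1 + t)) => [e e0|]; last by rewrite addr_ge0 ?ltW.
have se0 : 0 < Num.sqrt e by rewrite sqrtr_gt0.
have [f df] := comp_restriction_core du se0.
rewrite !nrm_lt// sqr_sqrtr ?(ltW e0)// => -[n1 n2].
have [dBf dTBf] := df; have dCf := dC _ df; have /= eCf := eC _ df.
have lC : linear_op C by case: saC => -[].
have symC : rip ip (app C v) f = rip ip (app C f) v.
  by rewrite (ripC hilb (app C f)) /rip (self_adjoint_symmetric saC).
have posC : 0 <= rip ip (app C (v - f)) (v - f).
  by have := nC _ (subspaceB lC.1 dv dCf); rewrite lecE => /andP[].
have pos := rip_ge0 hilb (v - f).
have hv : rip ip v h = rip ip (app C v) v + t * rip ip v v.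
  by rewrite -ev !(ripE hilb) (ripC hilb v (app C v)).
have hf : rip ip f h = rip ip (app C v) f + t * rip ip v f.
  by rewrite -ev !(ripE hilb) !(ripC hilb f).
have hf' : rip ip f h = rip ip (app B u) (app B f) + t * rip ip u f.
  rewrite -eu !(ripE hilb) !(ripC hilb f); congr (_ + _).
  by rewrite /rip /= symB.
have hu : rip ip u h = rip ip (app B u) (app B u) + t * rip ip u u.
  by rewrite -eu !(ripE hilb) /=; congr (_ + _); rewrite /rip symB.
have Cff : rip ip (app C f) f = rip ip (app B f) (app B f).
  by rewrite -eCf appT// /rip symB//; apply: dTB.
have {}n1 : t * rip ip (u - f) (u - f) < t * e by rewrite ltr_pM2l.
have {}pos := mulr_ge0 (ltW t0) pos.
move: posC pos n1 n2; rewrite linear_opB//.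
rewrite !(ripE hilb) Cff -symC (ripC hilb f v) (ripC hilb f u).
rewrite (ripC hilb (app B f)).
lra.
Qed.

(** Testing against [f] in [dom (T B)] amounts to testing against [x = B f] in [dom T]; writing
    [h = B w] then gives [S g = w], which lies in [dom B]. *)
Lemma comp_restriction_adjoint (S : Op V) : is_adjoint ip T S ->
  is_adjoint ip (Defs.comp T B) (Defs.comp B S).
Proof.
move=> TS; have [_ [_ aS]] := TS.
have comp_adj f g : dom (Defs.comp T B) f -> dom (Defs.comp B S) g ->
    ip (app T (app B f)) g = ip f (app B (app S g)).
  by move=> [df dTf] [dg dBg]; rewrite aS// symB.
split; first exact: comp_restriction_dense.
split=> [|g dg f df]; last exact: comp_adj.
apply/seteqP; split=> [g dg|g [h gh]].
  by exists (app B (app S g)) => f df; exact: comp_adj.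
have [w dw wh] := surB h.
have [|dg eg] := @adjoint_intro _ _ _ hilb _ _ g w TS; last by split=> //; rewrite eg.
move=> x dx; have [f df fx] := surB x.
by rewrite -{2}fx symB// wh -gh /= ?fx//; split=> //=; rewrite fx.
Qed.

(** With [B f = S v] one has [C f = T S v = h - a v], and the non-negative number
    [(C (u - f), u - f) + a |u - v|^2] is exactly [(v, h) - (u, h)]. *)
Lemma comp_restriction_krein (S : Op V) : is_adjoint ip T S ->
  is_krein ip (Defs.comp T B) (Defs.comp T S).
Proof.
move=> TS; have [_ [_ aS]] := TS.
have BS f : dom B f -> dom S f /\ app S f = app B f.
  move=> df; apply: (adjoint_intro hilb TS) => g dg.
  by rewrite appT// symB//; apply: dTB.
split; first exact: comp_adjoint_nonneg_self_adjoint.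
split; first by split=> f [df dTf] /=; have [dSf eSf] := BS f df; rewrite ?eSf.
move=> C [saC nC] [dC eC] a h u v a0 du eu [dv dSv] ev.
have [t t0 at_] : exists2 t : R, 0 < t & a = t%:C.
  by have [s s0 ->] := posC a0; exists (s ^+ 2); rewrite ?exprn_gt0.
subst a.
have ureal : ip u h = (rip ip u h)%:C.
  by rewrite -eu; apply: ip_shift_real => //; apply: nC.
have vreal : ip v h = (rip ip v h)%:C.
  rewrite -ev; apply: (@ip_shift_real _ _ _ hilb (Defs.comp T S)) => /=.
  by rewrite aS.
rewrite ureal vreal lecR.
have [f dBf ef] := surB (app S v).
have df : dom (Defs.comp T B) f by split=> //; rewrite ef.
have dCf := dC _ df.
have Cf : app C f = app T (app S v) by rewrite -eC //= ef.
have lC : linear_op C by case: saC => -[].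
have symC : rip ip (app C u) f = rip ip u (app C f).
  by rewrite /rip (self_adjoint_symmetric saC).
have posC : 0 <= rip ip (app C (u - f)) (u - f).
  by have := nC _ (subspaceB lC.1 du dCf); rewrite lecE => /andP[].
have pos := rip_ge0 hilb (u - v).
have hu : rip ip u h = rip ip (app C u) u + t * rip ip u u.
  by rewrite -eu !(ripE hilb) (ripC hilb u (app C u)).
have hu' : rip ip u h = rip ip u (app C f) + t * rip ip u v.
  by rewrite -ev !(ripE hilb) Cf.
have hv : rip ip v h = rip ip (app S v) (app S v) + t * rip ip v v.
  by rewrite -ev !(ripE hilb) /= (ripC hilb v) /rip aS.
have Cff : rip ip (app C f) f = rip ip (app S v) (app S v).
  by rewrite Cf appT// /rip symB//; [rewrite ef | apply: dTB].
have {}pos := mulr_ge0 (ltW t0) pos.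
move: posC pos; rewrite linear_opB//.
rewrite !(ripE hilb) Cff symC (ripC hilb v u) (ripC hilb (app C f) u).
lra.
Qed.

End Restriction.

(** * The operator B + i and the restrictions of B *)

Section Shift.
Variables (R : realType) (V : lmodType R[i]) (ip : V -> V -> R[i]).
Hypothesis hilb : hilbert_axioms ip.
Variable B : Op V.
Hypothesis saB : self_adjoint ip B.
Implicit Types (F : set V).

Let lB : linear_op B. Proof. by case: saB => -[]. Qed.
Let sD : subspace (dom B). Proof. by case: lB. Qed.
Let cB : closed_op ip B. Proof. exact: adjoint_closed saB. Qed.
Let symB f g : dom B f -> dom B g -> ip (app B f) g = ip f (app B g).
Proof. exact: self_adjoint_symmetric. Qed.

Definition shift (b : V) : V := app B b + 'i *: b.
Definition shift_adj (b : V) : V := app B b - 'i *: b.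

Let mulii : 'i * 'i = -1 :> R[i]. Proof. by rewrite -expr2 sqr_i. Qed.

Let conjc_i : ('i : R[i])^* = - 'i.
Proof. by apply/eqP; rewrite eq_complex /= oppr0 !eqxx. Qed.

Lemma shift_linear a x y : dom B x -> dom B y ->
  shift (a *: x + y) = a *: shift x + shift y.
Proof.
move=> dx dy; rewrite /shift; case: lB => _ ->//.
by rewrite !scalerDr !scalerA mulrC addrACA.
Qed.

Lemma shift0 : shift 0 = 0.
Proof. by rewrite /shift linear_op0// scaler0 addr0. Qed.

Lemma shiftD x y : dom B x -> dom B y -> shift (x + y) = shift x + shift y.
Proof. by move=> dx dy; rewrite -{1}[x]scale1r shift_linear// scale1r. Qed.

Lemma shiftZ a x : dom B x -> shift (a *: x) = a *: shift x.
Proof.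
by move=> dx; rewrite -[a *: x]addr0 shift_linear ?shift0 ?addr0//; case: sD.
Qed.

Lemma shiftB x y : dom B x -> dom B y -> shift (x - y) = shift x - shift y.
Proof.
move=> dx dy; rewrite shiftD//; last exact: subspaceN.
by rewrite -[- y]scaleN1r shiftZ// scaleN1r.
Qed.

Lemma ip_shift b z : dom B b -> dom B z -> ip (shift b) z = ip b (shift_adj z).
Proof.
move=> db dz; rewrite /shift /shift_adj (ipDl hilb) (ipBr hilb) symB//.
by rewrite (ipZl hilb) (ipZr hilb) conjc_i mulNr opprK.
Qed.

(** Symmetry of [B] cancels the cross terms, so [shift] dominates both [b] and [B b]. *)
Lemma rip_shift b : dom B b ->
  rip ip (shift b) (shift b) = rip ip (app B b) (app B b) + rip ip b b.
Proof.
move=> db; rewrite {1 2}/shift !(ripE hilb) -addrA; congr (_ + _).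
rewrite addrA addrC /rip !(ipZl hilb) !(ipZr hilb) symB// mulrA conjc_i mulrN mulii opprK mul1r.
case: (ip b (app B b)) => p q /=; ring.
Qed.

Lemma nrm_le_shift b : dom B b -> nrm ip b <= nrm ip (shift b).
Proof. by move=> db; rewrite ler_wsqrtr// rip_shift// lerDr rip_ge0. Qed.

Lemma nrm_B_le_shift b : dom B b -> nrm ip (app B b) <= nrm ip (shift b).
Proof. by move=> db; rewrite ler_wsqrtr// rip_shift// lerDl rip_ge0. Qed.

Lemma shift_inj x y : dom B x -> dom B y -> shift x = shift y -> x = y.
Proof.
move=> dx dy e; apply/eqP; rewrite -subr_eq0; apply/eqP/(nrm_eq0 hilb)/le_anti.
rewrite nrm_ge0 andbT; have := nrm_le_shift (subspaceB sD dx dy).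
by rewrite shiftB// e subrr {2}/nrm rip0l// sqrtr0.
Qed.

Lemma shift_surjective h : exists2 b, dom B b & shift b = h.
Proof.
(* [B^2 + 1] is onto and factors as [(B + i) (B - i)], so [(B - i) u] is a preimage. *)
have [u [du dBu] <-] := comp_adjoint_surjective hilb h cB saB.
have diu : dom B ('i *: u) by apply: subspaceZ.
exists (app B u - 'i *: u); first exact: subspaceB.
rewrite shiftB// shiftZ// /shift scalerDr scalerA mulii scaleN1r.
by rewrite opprD opprK -addrA (addrA (_ *: _)) subrr add0r.
Qed.

Lemma shift_adj_surjective h : exists2 b, dom B b & shift_adj b = h.
Proof.
have [u [du dBu] <-] := comp_adjoint_surjective hilb h cB saB.
have diu : dom B ('i *: u) by apply: subspaceZ.
exists (app B u + 'i *: u); first exact: subspaceD.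
rewrite /shift_adj linear_opD// linear_opZ// scalerDr scalerA mulii scaleN1r.
by rewrite opprD opprK -addrA (addrA ('i *: _)) subrr add0r.
Qed.

(** The domain of the operator [B_F] described at the outset. *)
Definition shift_preim F : set V := [set b | dom B b /\ oc ip F (shift b)].

Lemma shift_preim_subspace F : subspace (shift_preim F).
Proof.
have [oc0 ocD] := oc_subspace hilb F.
split; first by split; [case: sD|rewrite shift0].
move=> a x y [dx Fx] [dy Fy]; split; first by case: sD => _; apply.
by rewrite shift_linear//; apply: ocD.
Qed.

(** If [(B - i) z] is orthogonal to this set, then [(A b, z) = (b, (B - i) z) = 0]; as [A b] runs
    through all of [oc F], [z] lies in [oc (oc F)] and in [dom B]. *)
Lemma shift_preim_dense F :
  (forall x, dom B x -> oc ip (oc ip F) x -> x = 0) -> dense ip (shift_preim F).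
Proof.
move=> h; apply: (dense_oc hilb); first exact: shift_preim_subspace.
move=> y; have [z dz <-] := shift_adj_surjective y => oz.
suff -> : z = 0 by rewrite /shift_adj linear_op0// scaler0 subr0.
apply: h => // x xF; have [b db bx] := shift_surjective x.
by rewrite -bx ip_shift// oz//; split=> //; rewrite bx.
Qed.

Definition shift_restr F : Op V := mkOp (shift_preim F) (app B).

Lemma shift_restr_closed F : closed_op ip (shift_restr F).
Proof.
split; first split=> [|a x y [dx _] [dy _]].
- exact: shift_preim_subspace.
- by case: lB => _; apply.
move=> u x y du ux uy.
have [dx ex] := cB.2 u x y (fun n => (du n).1) ux uy.
split=> //; split=> // f Ff; apply: (ip_eq0C hilb).
have xy : adherent (ip_prod ip) (graph (shift_restr F)) (x, y).
  apply: (@cvg_adherent _ _ _ (hilbert_prod hilb) _ (fun n => (u n, app B (u n)))).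
    by move=> n; exact: (conj (du n) erefl).
  exact/seq_converges_prod.
(* The condition [(A b, f) = 0] says that [(b, B b)] is orthogonal to [(- i f, f)], so it passes to
   limits in the graph. *)
have := adherent_ip0 (hilbert_prod hilb) xy (z := (- 'i *: f, f)).
have ipE b : ip b (- 'i *: f) + ip (app B b) f = ip (shift b) f.
  rewrite /shift (ipDl hilb) (ipZl hilb) scaleNr (ipNr hilb) (ipZr hilb) conjc_i mulNr opprK.
  by rewrite addrC.
rewrite /ip_prod /= -ex ipE; apply=> -[s1 s2] [/= [ds os] /= ->].
by rewrite ipE; apply: (ip_eq0C hilb); apply: os.
Qed.

End Shift.

(** * The uniform boundedness principle *)

Section UniformBoundedness.
Variables (R : realType) (V : lmodType R[i]) (ip : V -> V -> R[i]).
Hypothesis hilb : hilbert_axioms ip.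

(* Gliding hump: in the ball of radius 4^-n around x_n every p satisfies
   n <= |rip p e| for some e, and these balls are nested. *)
Lemma uniform_boundedness (E : set V) :
  (forall M : R, exists2 e, E e & M < nrm ip e) ->
  exists p, forall M : R, exists2 e, E e & M < `|rip ip p e|.
Proof.
move=> unbE; pose rho (n : nat) : R := 4^-1 ^+ n.
have rho0 n : 0 < rho n by rewrite exprn_gt0// invr_gt0.
have step (nx : nat * V) : exists x', nrm ip (x' - nx.2) <= rho nx.1 / 2 /\
    (* Moving [x] by [rho n / 2] along [e], in the direction of the sign of [rip x e], makes the
       pairing at least [rho n / 2 * nrm e]. A further move by [rho n / 4] costs at most half of
       that, and the rest exceeds [n] by the choice of [e]. *)
    forall y, nrm ip (y - x') <= rho nx.1 / 4 ->
      exists2 e, E e & nx.1%:R < `|rip ip y e|.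
  case: nx => n x /=; have [e Ee lt] := unbE (n%:R * 4 / rho n).
  have e0 : 0 < nrm ip e.
    by apply: le_lt_trans lt; rewrite divr_ge0 ?mulr_ge0// ltW.
  pose s : R := if 0 <= rip ip x e then 1 else -1.
  pose t := s * (rho n / 2 / nrm ip e).
  have abst : `|t| * nrm ip e = rho n / 2.
    have s1 : `|s| = 1 by rewrite /s; case: ifP => _; rewrite ?normrN normr1.
    rewrite /t normrM s1 mul1r.
    by rewrite ger0_norm ?divfK ?gt_eqF// ?divr_ge0 ?ltW// divr_gt0.
  exists (x + t%:C *: e); rewrite addrC addKr nrmZ// abst lexx; split=> // y ly.
  exists e => //.
  have big : rho n / 2 * nrm ip e <= `|rip ip (x + t%:C *: e) e|.
    rewrite !(ripE hilb) -(sqr_nrm hilb).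
    have te : t * nrm ip e ^+ 2 = s * (rho n / 2 * nrm ip e).
      by rewrite /t; field; rewrite gt_eqF.
    have p0 : 0 <= rho n / 2 * nrm ip e by rewrite mulr_ge0 ?divr_ge0 ?ltW.
    rewrite te /s; case: ifP => [h|/negbT]; last rewrite -ltNge => h.
      by rewrite mul1r ger0_norm ?addr_ge0// lerDr.
    by rewrite mulN1r -opprB normrN ger0_norm; lra.
  have dif := normr_rip_le_nrm hilb (y - (x + t%:C *: e)) e.
  have := ler_normB (rip ip y e) (rip ip (y - (x + t%:C *: e)) e).
  rewrite [X in `|_ - X|]ripDl// ripNl// opprD opprK addrA subrr add0r => tri.
  have : nrm ip (y - (x + t%:C *: e)) * nrm ip e <= rho n / 4 * nrm ip e.
    by rewrite ler_wpM2r ?nrm_ge0// addrC.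
  move: lt; rewrite ltr_pdivrMr// => lt; lra.
have [next hnext] := choice step.
pose x := fix x n := if n is m.+1 then next (m, x m) else 0.
have rhoS n : rho n.+1 = rho n / 4 by rewrite /rho exprS mulrC.
have ball n k : nrm ip (x (n + k)%N - x n) + rho (n + k)%N <= rho n.
  elim: k => [|k IH]; first by rewrite addn0 subrr /nrm rip0l// sqrtr0 add0r.
  rewrite addnS; apply: le_trans IH.
  have [le1 _] := hnext ((n + k)%N, x (n + k)%N).
  have := nrm_distD hilb (x (n + k)%N) (x (n + k).+1) (x n).
  rewrite rhoS; have := rho0 (n + k)%N.
  move: le1; rewrite /=; lra.
have ball' n m : (n <= m)%N -> nrm ip (x m - x n) <= rho n.
  move=> /subnKC <-; have := ball n (m - n)%N.
  have := rho0 (n + (m - n))%N; lra.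
have rhoN (e : R) : 0 < e -> exists N, rho N < e.
  move=> e0; have [N hN] := harm_lt e0; exists N; apply: le_lt_trans (hN N (leqnn N)).
  rewrite /rho exprVn lef_pV2 ?posrE ?exprn_gt0 ?ltr0n//.
  by rewrite -natrX ler_nat; apply: ltn_expl.
have [p xp] : exists p, seq_converges ip x p.
  apply: nrm_cauchy_cvg => // e e0.
  have [N hN] := rhoN (e / 2) ltac:(by rewrite divr_gt0).
  exists N => n m /ball' hn /ball' hm.
  have := nrm_distD hilb (x N) (x n) (x m).
  rewrite [nrm ip (x N - _)](nrm_distC hilb); lra.
have px n : nrm ip (p - x n) <= rho n.
  apply/ler_addgt0Pl => e e0.
  have /(seq_convergesP hilb)/(_ e e0)[N hN] := xp.
  have lt := hN _ (leq_maxl N n); have le := ball' _ _ (leq_maxr N n).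
  have := nrm_distD hilb (x (maxn N n)) p (x n).
  rewrite (nrm_distC hilb p (x (maxn N n))) => tri.
  by move: tri lt le; clear; lra.
exists p => M; pose n := (Num.truncn `|M|).+1.
have [_ /(_ p)[|e Ee lt]] := hnext (n, x n).
  by rewrite -rhoS; exact: (px n.+1).
exists e => //; apply: le_lt_trans lt; apply: le_trans (ler_norm _) _.
exact/ltW/truncnS_gt.
Qed.
End UniformBoundedness.

(** * Construction of the pairs *)

Section Construction.
Variables (R : realType) (V : lmodType R[i]) (ip : V -> V -> R[i]).
Hypothesis hilb : hilbert_axioms ip.
Variable B : Op V.
Hypothesis saB : self_adjoint ip B.
Implicit Types (F : set V).

Let lB : linear_op B. Proof. by case: saB => -[]. Qed.
Let sD : subspace (dom B). Proof. by case: lB. Qed.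
Let cB : closed_op ip B. Proof. exact: adjoint_closed saB. Qed.
Let symB f g : dom B f -> dom B g -> ip (app B f) g = ip f (app B g).
Proof. exact: self_adjoint_symmetric. Qed.
Let ip0 x : ip x x = 0 -> x = 0.
Proof. by case: hilb => _ _ _ h _; apply: h. Qed.

Definition dom_free F := forall x, dom B x -> F x -> x = 0.

(** A bound for [B + i] on this dense subspace would extend, by closedness of [B], to a bound for
    [B] on all of [dom B]. *)
Lemma shift_preim_unbounded F (M : R) : unbounded ip B -> dom_free (oc ip (oc ip F)) ->
  exists2 b, shift_preim ip B F b & M * nrm ip b < nrm ip (shift B b).
Proof.
move=> unB hF; apply: contrapT => nex; apply: unB.
have bnd b : shift_preim ip B F b -> nrm ip (app B b) <= `|M| * nrm ip b.
  move=> Wb; apply: le_trans (nrm_B_le_shift hilb saB Wb.1) _.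
  apply: (@le_trans _ _ (M * nrm ip b)); last by rewrite ler_wpM2r ?nrm_ge0 ?ler_norm.
  by rewrite leNgt; apply/negP => lt; apply: nex; exists b.
have sW := shift_preim_subspace hilb saB F.
have bnd' v : dom B v -> nrm ip (app B v) <= `|M| * nrm ip v.
  move=> dv; have /(denseP hilb)/(_ v)/(adherent_seq hilb)[u [Wu uv]] :=
    shift_preim_dense hilb saB hF.
  have M1 : 0 < `|M| + 1 by rewrite ltr_wpDl.
  have [y Buy] : exists y, seq_converges ip (fun n => app B (u n)) y.
    apply: nrm_cauchy_cvg => // e e0.
    have e1 : 0 < e / (`|M| + 1) / 2 by rewrite !divr_gt0.
    have /(seq_convergesP hilb)/(_ _ e1)[N hN] := uv.
    exists N => n m /hN lt1 /hN lt2.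
    have [dn _] := Wu n; have [dm _] := Wu m.
    rewrite -linear_opB//; apply: le_lt_trans (bnd _ (subspaceB sW (Wu n) (Wu m))) _.
    have tri := nrm_distD hilb v (u n) (u m).
    rewrite (nrm_distC hilb v) in tri.
    have lt : nrm ip (u n - u m) < e / (`|M| + 1) by lra.
    apply: (@le_lt_trans _ _ ((`|M| + 1) * nrm ip (u n - u m))).
      by rewrite ler_wpM2r ?nrm_ge0// lerDl.
    by rewrite mulrC -ltr_pdivlMr.
  have [_ By] := cB.2 u v y (fun n => (Wu n).1) uv Buy.
  rewrite By -subr_le0; apply: (@le0_of_lt _ _ (`|M| + 1)) => [e e0|]; last exact: ltW.
  have /(seq_convergesP hilb)/(_ _ e0)[N1 hN1] := uv.
  have /(seq_convergesP hilb)/(_ _ e0)[N2 hN2] := Buy.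
  have lt1 := hN1 _ (leq_maxl N1 N2); have lt2 := hN2 _ (leq_maxr N1 N2).
  move: (maxn N1 N2) lt1 lt2 => n lt1 lt2.
  have tri1 := nrmD hilb (u n - v) v; have tri2 := nrmD hilb (y - app B (u n)) (app B (u n)).
  rewrite !subrK in tri1 tri2; rewrite (nrm_distC hilb) in lt2.
  have le := bnd _ (Wu n).
  have le' : `|M| * nrm ip (u n) <= `|M| * (e + nrm ip v).
    by rewrite ler_wpM2l//; lra.
  lra.
exists (`|M| ^+ 2)%:C => f df; rewrite !(ipxx hilb) -rmorphM lecR -!(sqr_nrm hilb).
by rewrite -exprMn ler_pXn2r ?nnegrE ?mulr_ge0 ?nrm_ge0// bnd'.
Qed.

Definition dom_plus F : set V :=
  [set z | exists x y, [/\ dom B x, oc ip (oc ip F) y & z = x + y]].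

Lemma dom_plus_subspace F : subspace (dom_plus F).
Proof.
have [o0 oD] := oc_subspace hilb (oc ip F).
split; first by exists 0, 0; split; rewrite ?addr0//; case: sD.
move=> a _ _ [x1 [y1 [d1 o1 ->]]] [x2 [y2 [d2 o2 ->]]].
exists (a *: x1 + x2), (a *: y1 + y2); split; [by case: sD => _; apply|exact: oD|].
by rewrite scalerDr addrACA.
Qed.

(** Let [q] be the component in [oc F] of a vector [p] whose pairings with [E] are unbounded. If
    [q = x + y] as in [dom_plus], the pairings reduce to [(x, A b)], of modulus [|((B - i) x, b)|],
    hence at most [|(B - i) x|]. *)
Lemma dom_plus_proper F : unbounded ip B -> dom_free (oc ip (oc ip F)) ->
  exists q, oc ip F q /\ ~ dom_plus F q.
Proof.
move=> unB hF.
pose E := [set shift B b | b in [set b | shift_preim ip B F b /\ nrm ip b <= 1]].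
have [|p hp] := @uniform_boundedness _ _ _ hilb E.
  move=> M; have [b Wb lt] := shift_preim_unbounded `|M| unB hF.
  have b0 : 0 < nrm ip b.
    rewrite lt_def nrm_ge0 andbT; apply/eqP => b0; move: lt.
    by rewrite (nrm_eq0 hilb b0) (shift0 saB) /nrm (rip0l hilb) sqrtr0 mulr0 ltxx.
  exists (shift B ((nrm ip b)^-1%:C *: b)).
    exists ((nrm ip b)^-1%:C *: b) => //; split.
      exact: subspaceZ (shift_preim_subspace hilb saB F) Wb.
    by rewrite nrmZ// ger0_norm ?invr_ge0 ?nrm_ge0// mulVf// gt_eqF.
  rewrite (shiftZ saB)//; last exact: Wb.1.
  rewrite nrmZ// ger0_norm ?invr_ge0 ?nrm_ge0// mulrC ltr_pdivlMr//.
  by apply: le_lt_trans lt; rewrite ler_pM2r// ler_norm.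
have [q [r [oq or pqr]]] := oc_decomp hilb F p.
exists q; split=> // -[x [y [dx oy qxy]]].
have [_ [b [[db ob] b1] <-]] := hp (nrm ip (shift_adj B x)).
rewrite pqr qxy -addrA ripDl//.
have oyr : oc ip (oc ip F) (y + r) by exact: subspaceD (oc_subspace hilb _) oy or.
have -> : rip ip (y + r) (shift B b) = 0.
  by rewrite ripC// /rip oyr.
rewrite addr0 ripC// {1}/rip (ip_shift hilb saB db dx) -/(rip ip _ _) ltNge => /negP; apply.
apply: le_trans (normr_rip_le_nrm hilb _ _) _.
by rewrite ler_piMl ?nrm_ge0.
Qed.

(** With [s = A w'] and [d = A b0] the estimate is Cauchy-Schwarz for [(w' - b0, (B - i) x)], so
    only [w'] has to be close to [b0]. *)
Lemma dom_free_step F d (e : R) : unbounded ip B -> dom_free (oc ip (oc ip F)) -> 0 < e ->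
  exists s, [/\ oc ip F s, ~ dom_plus F s &
    forall x, dom B x -> `|rip ip (s - d) x| <= e * nrm ip (shift_adj B x)].
Proof.
move=> unB hF e0; have [q [oq nq]] := dom_plus_proper unB hF.
have [b0 db0 <-] := shift_surjective hilb saB d.
have [bq dbq qE] := shift_surjective hilb saB q.
have e2 : 0 < e / 2 by rewrite divr_gt0.
have [w Ww lt] : exists2 w, shift_preim ip B F w & nrm ip (b0 - w) < e / 2.
  by have /(denseP hilb)/(_ b0 _ e2) := shift_preim_dense hilb saB hF.
suff [w' Ww' [nw' lt']] : exists2 w', shift_preim ip B F w' &
    ~ dom_plus F (shift B w') /\ nrm ip (w' - b0) <= e.
  exists (shift B w'); split => // [|x dx]; first by case: Ww'.
  have [dw' _] := Ww'.
  rewrite -(shiftB saB dw' db0) /rip (ip_shift hilb saB)//; last exact: subspaceB.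
  apply: le_trans (normr_rip_le_nrm hilb _ _) _.
  by rewrite ler_wpM2r ?nrm_ge0.
have [nw|] := pselect (~ dom_plus F (shift B w)).
  by exists w => //; split=> //; rewrite nrm_distC//; lra.
move/contrapT => pw.
have n1 : 0 < nrm ip bq + 1 by rewrite ltr_wpDl ?nrm_ge0.
(* If [A w] falls into [dom_plus F], a small multiple of [bq], with [A bq = q] outside it, moves [w]
   out at a cost of at most [e / 2]. *)
pose t := e / 2 / (nrm ip bq + 1).
have t0 : 0 < t by rewrite divr_gt0.
have Wq : shift_preim ip B F bq by split; rewrite ?qE.
have dtq : dom B (t%:C *: bq) by apply: subspaceZ.
have sW := shift_preim_subspace hilb saB F.
exists (w + t%:C *: bq); first by apply: subspaceD => //; apply: subspaceZ.
split.
  rewrite (shiftD saB Ww.1 dtq) (shiftZ saB _ dbq) qE => h; apply: nq.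
  have := subspaceB (dom_plus_subspace F) h pw.
  rewrite addrC addKr => /(subspaceZ (t^-1)%:C (dom_plus_subspace F)).
  by rewrite scalerA -rmorphM /= mulVf ?gt_eqF// scale1r.
rewrite addrAC; apply: le_trans (nrmD hilb _ _) _.
rewrite nrm_distC// nrmZ// gtr0_norm//.
have : t * nrm ip bq <= e / 2.
  by rewrite /t mulrAC ler_pdivrMr// ler_pM2l// lerDl.
lra.
Qed.

(** Modulo [oc (oc F)], [x] is a multiple [c *: s]; with [c] non-zero, [s] would lie in
    [dom_plus F]. *)
Lemma dom_free_extend F s : oc ip F s -> ~ dom_plus F s -> dom_free (oc ip (oc ip F)) ->
  dom_free (oc ip (oc ip (F `|` [set s]))).
Proof.
move=> os ns hF x dx ox.
have s0 : ip s s != 0.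
  apply/eqP => /ip0 s0; apply: ns; rewrite s0.
  by case: (dom_plus_subspace F).
pose c := ((ip s x / ip s s)^*)%C.
have of_ : oc ip (oc ip F) (x - c *: s).
  move=> y oy; pose y' := y - (ip y s / ip s s) *: s.
  have oy' : oc ip (F `|` [set s]) y'.
    move=> g [Fg|->].
      by rewrite (ipBr hilb) (ipZr hilb) (oy g Fg) (os g Fg) mulr0 subr0.
    apply: (ip_eq0C hilb).
    by rewrite (ipBl hilb) (ipZl hilb) divfK// subrr.
  have /eqP := ox _ oy'; rewrite (ipBl hilb) (ipZl hilb) subr_eq0 => /eqP yx.
  rewrite (ipBr hilb) (ipZr hilb) conjcK yx; field.
  exact: s0.
have [c0|c0] := eqVneq c 0.
  by apply: hF => //; rewrite c0 scale0r subr0 in of_.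
case: ns; exists (c^-1 *: x), (- (c^-1 *: (x - c *: s))); split.
- exact: subspaceZ.
- have sO := oc_subspace hilb (oc ip F).
  exact: subspaceN sO (subspaceZ _ sO of_).
- by rewrite scalerBr scalerA mulVf// scale1r opprB addrC subrK.
Qed.

Lemma dom_free_sequence : unbounded ip B -> (exists s : nat -> V, dense ip (range s)) ->
  exists s : nat -> V, [/\ forall j k, j != k -> ip (s j) (s k) = 0,
    forall k, s k <> 0 &
    forall (b : bool) x, dom B x -> (forall n, ip (s (n.*2.+2 + b)%N) x = 0) -> x = 0].
Proof.
move=> unB [d dd].
(* Indices [2 n + 2] and [2 n + 3] both decode [n] to a pair [(m, i)]: approximate [d m] with
   tolerance [1 / (i + 1)]. Each pair thus occurs in both parities from index 2 on, which leaves
   [s 0] and [s 1] for varying the set. Numbers that encode no pair get [(0, 0)]. *)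
pose target k : nat * nat := odflt (0, 0)%N (unpickle k./2.-1).
have next (Fk : set V * nat) : exists s, dom_free (oc ip (oc ip Fk.1)) ->
    [/\ oc ip Fk.1 s, ~ dom_plus Fk.1 s &
     forall x, dom B x -> `|rip ip (s - d (target Fk.2).1) x| <=
       (target Fk.2).2.+1%:R^-1 * nrm ip (shift_adj B x)].
  (* The value 0 is a placeholder for sets that are not [dom_free]; [hFs] shows that the recursion
     never meets one. *)
  have [hF|nF] := pselect (dom_free (oc ip (oc ip Fk.1))); last by exists 0.
  have e0 : 0 < (target Fk.2).2.+1%:R^-1 :> R by rewrite invr_gt0 ltr0n.
  by have [s hs] := dom_free_step (d (target Fk.2).1) unB hF e0; exists s.
have [nxt hnxt] := choice next.
pose Fs := fix Fs k : set V :=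
  if k is j.+1 then Fs j `|` [set nxt (Fs j, j)] else set0.
pose s k := nxt (Fs k, k).
have hFs k : dom_free (oc ip (oc ip (Fs k))).
  elim: k => [|k IH] /=.
    by move=> x dx ox; apply: ip0; apply: ox.
  by have [os ns _] := hnxt (Fs k, k) IH; apply: dom_free_extend.
have inFs j k : (j < k)%N -> Fs k (s j).
  elim: k => // k IH; rewrite ltnS leq_eqVlt => /predU1P[->|/IH]; first by right.
  by left.
have orth j k : (j < k)%N -> ip (s j) (s k) = 0.
  by move=> jk; have [os _ _] := hnxt (Fs k, k) (hFs k); apply/os/inFs.
exists s; split.
- move=> j k; rewrite neq_ltn => /orP[/orth//|/orth kj].
  exact: (ip_eq0C hilb).
- move=> k sk; have [_ ns _] := hnxt (Fs k, k) (hFs k); apply: ns.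
  by rewrite -/(s k) sk; case: (dom_plus_subspace (Fs k)).
move=> b x dx hx.
(* For fixed [m] every tolerance occurs at an index of parity [b], so [rip (d m) x] is arbitrarily
   small; density of [d] then yields [x = 0]. *)
suff dx0 m : rip ip (d m) x = 0.
  apply: (rip_eq0 hilb); apply: (adherent_rip0 hilb (S := range d)).
    exact: (denseP hilb _).1.
  by move=> _ [m _ <-].
apply/eqP; rewrite -normr_le0.
apply: (@le0_of_lt _ _ (nrm ip (shift_adj B x) + 1)) => [e e0|]; last first.
  by rewrite addr_ge0 ?nrm_ge0.
have [i hi] := harm_lt e0; have {}hi := hi i (leqnn i).
pose n := pickle (m, i); pose k := (n.*2.+2 + b)%N.
have tk : target k = (m, i).
  rewrite /target; have -> : k./2.-1 = n.
    by rewrite /k /= addnC halfD /= doubleK; case: b {hx} k => //=; rewrite odd_double.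
  by rewrite /n pickleK.
have [_ _ /(_ x dx)] := hnxt (Fs k, k) (hFs k).
rewrite /= tk -/(s k) ripDl// ripNl// {1}/rip hx /= sub0r normrN.
move=> /le_lt_trans; apply.
have := nrm_ge0 ip (shift_adj B x).
move: (i.+1%:R^-1) hi => a; nra.
Qed.

(** The common source of (3) and (4): [A b = B b + i b] stays in [dom B] when [B b] does. *)
Lemma shift_restr_cap_dom F b : dom_free (oc ip F) ->
  shift_preim ip B F b -> dom B (app B b) -> b = 0.
Proof.
move=> hF [db ob] dBb; have [d0 _] := sD.
apply: (shift_inj hilb saB db d0); rewrite (shift0 saB).
by apply: hF => //; apply: subspaceD => //; apply: subspaceZ.
Qed.

Lemma shift_restr_good_pair F : dom_free (oc ip F) -> dom_free (oc ip (oc ip F)) ->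
  good_pair ip B (shift_restr ip B F) (shift_restr ip B (oc ip F)).
Proof.
move=> h1 h2; have [d0 _] := sD.
have c1 := shift_restr_closed hilb saB F.
have c2 := shift_restr_closed hilb saB (oc ip F).
have dd1 : densely_defined ip (shift_restr ip B F).
  by split; [case: c1|apply: (shift_preim_dense hilb saB)].
have dd2 : densely_defined ip (shift_restr ip B (oc ip F)).
  by split; [case: c2|apply: (shift_preim_dense hilb saB); rewrite ocococ].
have r1 : restriction (shift_restr ip B F) B by split=> // x [].
have r2 : restriction (shift_restr ip B (oc ip F)) B by split=> // x [].
have W0 G : shift_preim ip B G 0 by case: (shift_preim_subspace hilb saB G).
have B0 : app B 0 = 0 by apply: linear_op0.
have cap : shift_preim ip B F `&` shift_preim ip B (oc ip F) = [set 0].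
  apply/seteqP; split=> [b [[db o1] [_ o2]]|_ ->]; last by split; apply: W0.
  apply: (shift_inj hilb saB db d0); rewrite (shift0 saB).
  exact: (oc_capC hilb o1 o2).
have sum : dom B = [set x + y | x in shift_preim ip B F & y in shift_preim ip B (oc ip F)].
  apply/seteqP; split=> [b db|_ [x [dx _] [y [dy _] <-]]]; last exact: subspaceD.
  have [p [q [op oq bpq]]] := oc_decomp hilb F (shift B b).
  have [x dx xp] := shift_surjective hilb saB p.
  have [y dy yq] := shift_surjective hilb saB q.
  exists x; first by split; rewrite ?xp.
  exists y; first by split; rewrite ?yq.
  apply: (shift_inj hilb saB) => //; first exact: subspaceD.
  by rewrite (shiftD saB)// xp yq.
have capB G : dom_free (oc ip G) ->
    shift_preim ip B G `&` dom (Defs.comp B B) = [set 0].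
  move=> hG; apply/seteqP; split=> [b [Wb [_ dBb]]|_ ->] /=.
    exact: shift_restr_cap_dom hG _ _.
  by rewrite B0; split.
have zero G : dom_free (oc ip G) -> zero_dom (Defs.comp B (shift_restr ip B G)).
  move=> hG; rewrite /zero_dom; apply/seteqP; split=> [b [Wb dBb]|_ ->] /=.
    exact: shift_restr_cap_dom hG _ _.
  by rewrite B0; split.
have zero' G : dom_free (oc ip G) ->
    zero_dom (Defs.comp (shift_restr ip B G) (shift_restr ip B G)).
  move=> hG; rewrite /zero_dom; apply/seteqP; split=> [b [Wb [dBb _]]|_ ->] /=.
    exact: shift_restr_cap_dom hG _ _.
  by rewrite B0; split.
split=> //.
- by split; [exact: capB h1|exact: capB h2].
- by split; split; [exact: zero|exact: zero|exact: zero'|exact: zero'].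
move=> surB; split=> [Bk hBk|].
  have [ck [dk rk]] : closed_op ip Bk /\ densely_defined ip Bk /\ restriction Bk B.
    by case: hBk => ->.
  split.
  - split; first exact: comp_restriction_dense.
    split; first exact: comp_restriction_nonneg.
    exact: comp_restriction_symmetric.
  - exact: comp_restriction_friedrichs.
  - exact: comp_restriction_adjoint.
  - exact: comp_restriction_krein.
(* A symmetric operator that is onto has trivial kernel, so (1) and (2) pull back along [B] to give
   (8). *)
have B_inj f : dom B f -> app B f = 0 -> f = 0.
  move=> df Bf; apply: ip0; have [g dg {1}<-] := surB f.
  by rewrite symB// Bf (ip0r hilb).
have cap' : dom (Defs.comp (shift_restr ip B F) B) `&`
    dom (Defs.comp (shift_restr ip B (oc ip F)) B) = [set 0].
  apply/seteqP; split=> [f [[df W1] [_ W2]]|_ ->] /=.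
    apply: B_inj => //; have : [set 0] (app B f) by rewrite -cap.
    by [].
  by rewrite B0.
split=> //; split=> //; apply/seteqP; split=> [f [df dBf]|].
  have := dBf; rewrite {1}sum => -[x Wx [y Wy xy]].
  have [f1 df1 e1] := surB x; have [f2 df2 e2] := surB y.
  exists f1; first by split=> //; rewrite e1.
  exists f2; first by split=> //; rewrite e2.
  apply/esym/eqP; rewrite -subr_eq0; apply/eqP/B_inj.
    by apply: subspaceB => //; apply: subspaceD.
  rewrite linear_opB//; last exact: subspaceD.
  by rewrite linear_opD// e1 e2 xy subrr.
move=> _ [f1 [df1 [d1 _]] [f2 [df2 [d2 _]] <-]]; split; first exact: subspaceD.
by rewrite linear_opD//; apply: subspaceD.
Qed.

End Construction.

(* "infinitely many pairs": a sequence of good pairs, pairwise distinct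
   (restrictions of B are determined by their domains) *)
Theorem theorem3p31 (R : realType) (V : lmodType R[i]) (ip : V -> V -> R[i])
    (hH : is_hilbert ip) (B : Op V) :
  self_adjoint ip B -> unbounded ip B ->
  exists P : nat -> Op V * Op V,
    (forall n m : nat, n <> m ->
       (dom (P n).1, dom (P n).2) <> (dom (P m).1, dom (P m).2)) /\
    (forall n : nat, good_pair ip B (P n).1 (P n).2).
Proof.
move=> saB unB; have [hilb [sep _]] := hH.
have [s [orth s0 free]] := dom_free_sequence hilb saB unB sep.
pose F n : set V := [set s 0%N + n%:R *: s 1%N] `|` [set s k.*2.+2 | k in setT].
pose u m : V := (m%:R * ip (s 1%N) (s 1%N)) *: s 0%N - ip (s 0%N) (s 0%N) *: s 1%N.
have nn0 k : ip (s k) (s k) != 0.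
  by apply/eqP => h; apply: (s0 k); case: hilb => _ _ _ + _; apply.
have ipu n m : ip (u m) (s 0%N + n%:R *: s 1%N) =
    (m%:R - n%:R) * (ip (s 0%N) (s 0%N) * ip (s 1%N) (s 1%N)).
  rewrite (ipBl hilb) !(ipZl hilb) !(ipDr hilb) !(ipZr hilb) conjc_nat.
  rewrite (orth 0 1)%N// (orth 1 0)%N//; ring.
have ou m : oc ip (F m) (u m).
  move=> f [->|[k _ <-]].
    by apply: (ip_eq0C hilb); rewrite ipu subrr mul0r.
  by rewrite (ipBr hilb) !(ipZr hilb) !(orth k.*2.+2)// !mulr0 subrr.
exists (fun n => (shift_restr ip B (F n), shift_restr ip B (oc ip (F n)))); split.
  move=> n m nm [e _]; apply: nm; apply/eqP.
  (* If the first domains for [n] and [m] coincide, they contain the preimage of [u m] under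
     [B + i], so [u m] is orthogonal to [F n]. *)
  have [b db bu] := shift_surjective hilb saB (u m).
  have : shift_preim ip B (F n) b by rewrite e; split; rewrite ?bu.
  move=> [_ /(_ (s 0%N + n%:R *: s 1%N) (or_introl erefl))].
  rewrite bu => /(ip_eq0C hilb)/eqP; rewrite ipu !mulf_eq0 !(negPf (nn0 _)) !orbF.
  by rewrite subr_eq0 eqr_nat eq_sym.
(* Even-indexed vectors from index 2 on lie in [F n], odd-indexed ones from index 3 on are
   orthogonal to [F n]; this gives the two conditions in turn. *)
move=> n; apply: (shift_restr_good_pair hilb saB) => x dx ox.
  by apply: (free false) => // k; apply: ox; right; exists k; rewrite ?addn0.
apply: (free true) => // k; apply: ox => f [->|[j _ <-]].
  by rewrite (ipDl hilb) (ipZl hilb) !orth ?addn1// mulr0 addr0.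
apply: orth; rewrite addn1 -!doubleS; apply/eqP => /(congr1 odd).
by rewrite /= !odd_double.
Qed.
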